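(* Let $R$ be a left Ore domain, let $Q^{n,n}_{\mathbf{q},\sigma}(R)=R_{\mathbf{q},\sigma}[x_1^{\pm1},\ldots,x_n^{\pm1}]$ be an $n$-multiparametric skew quantum torus over $R$, and let $\nu: Q(Q^{n,n}_{\mathbf{q},\sigma}(R))^*\rightarrow\Gamma$ be a valuation with $\nu(Q(R)^* )=0$. Then $\Gamma$ is abelian.
   Context: Rings are associative with $1$; $R^*$ is the group of units of $R$. Skew quantum torus: let $n\ge 2$, let $\mathbf{q}=[q_{ij}]\in M_n(R)$ satisfy $q_{ii}=1=q_{ij}q_{ji}=q_{ji}q_{ij}$ for all $1\le i,j\le n$, and let $\sigma=(\sigma_1,\ldots,\sigma_n)$ be automorphisms of $R$. The ring $Q^{n,n}_{\mathbf{q},\sigma}(R):=R_{\mathbf{q},\sigma}[x_1^{\pm1},\ldots,x_n^{\pm1}]$ is a ring containing $R$ as a subring, which is a free left $R$-module with basis $\{x^u=x_1^{u_1}\cdots x_n^{u_n} : u\in\mathbb{Z}^n\}$, and in which $x_ix_i^{-1}=1=x_i^{-1}x_i$, $x_ix_j=q_{ji}x_jx_i$, and $x_ir=\sigma_i(r)x_i$ for all $r\in R$ and $1\le i,j\le n$ (the data $\mathbf{q},\sigma$ are assumed such that this ring exists). For a left Ore domain $B$, $Q(B)$ denotes its total division ring of (left) fractions. When $R$ is a left Ore domain so is $Q^{n,n}_{\mathbf{q},\sigma}(R)$, and $Q(R)$ is regarded as a division subring of $Q(Q^{n,n}_{\mathbf{q},\sigma}(R))$. Valuation: for a division ring $D$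 and a totally ordered group $\Gamma$ (written additively, not necessarily commutative), a valuation $\nu:D^*\to\Gamma$ is a surjective map with $\nu(ab)=\nu(a)+\nu(b)$ for all $a,b\in D^*$ and $\nu(a+b)\ge\min\{\nu(a),\nu(b)\}$ whenever $a,b,a+b\in D^*$. *)

(* Defs.v *)
From HB Require Import structures.
From mathcomp Require Import all_boot all_order all_algebra.

Set Implicit Arguments.
Unset Strict Implicit.
Unset Printing Implicit Defensive.

Import Order.TTheory GRing.Theory.

Local Open Scope ring_scope.

(* Totally ordered groups, not necessarily commutative. The group law is      *)
(* written multiplicatively, since the additive groups of the library         *)
(* (zmodType) are all commutative.                                            *)
HB.mixin Record isOrderedGroup (d : Order.disp_t) G
    of Group G & Order.Total d G := {
  ogroup_le2l : forall z x y : G, (x <= y)%O -> (z * x <= z * y)%O%g;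
  ogroup_le2r : forall z x y : G, (x <= y)%O -> (x * z <= y * z)%O%g
}.

#[short(type="orderedGroupType")]
HB.structure Definition OrderedGroup (d : Order.disp_t) :=
  {G of isOrderedGroup d G & Group G & Order.Total d G}.

Definition domain (R : nzRingType) : Prop :=
  forall a b : R, a * b = 0 -> a = 0 \/ b = 0.

Definition left_ore_domain (R : nzRingType) : Prop :=
  domain R /\
  forall a b : R, a != 0 -> b != 0 ->
    exists c d : R, c * a = d * b /\ c * a != 0.

Definition division_ring (D : unitRingType) : Prop :=
  forall a : D, a != 0 -> a \is a GRing.unit.

(* a is a left fraction (f s)^-1 (f r), s != 0, of elements of the image of f *)
Definition left_fraction (B : nzRingType) (D : unitRingType)
    (f : B -> D) (a : D) : Prop :=
  exists s r : B, s != 0 /\ a = (f s)^-1 * f r.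

(* D, together with the embedding f, is the division ring of left fractions   *)
(* Q(B); this determines (D, f) up to a unique isomorphism.                   *)
Definition is_left_quotient_division_ring (B : nzRingType) (D : unitRingType)
    (f : {rmorphism B -> D}) : Prop :=
  [/\ division_ring D, injective f & forall a : D, left_fraction f a].

(* The factors are multiplied in increasing order of the indices.             *)
Definition monomial (n : nat) (S : unitRingType) (x : 'I_n -> S)
    (u : {ffun 'I_n -> int}) : S :=
  \prod_(i < n) x i ^ u i.

(* S, with the embedding iota of R and the variables x_i, is the n-multi-     *)
(* parametric skew quantum torus R_{q,sigma}[x_1^{+-1}, ..., x_n^{+-1}]. The  *)
(* left R-module structure of S is r, f |-> iota r * f.                       *)
Record is_skew_quantum_torus (n : nat) (R : nzRingType) (q : 'M[R]_n)
    (sigma : 'I_n -> {rmorphism R -> R}) (S : unitRingType)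
    (iota : {rmorphism R -> S}) (x : 'I_n -> S) : Prop := {
  sqt_qii : forall i, q i i = 1;
  sqt_qij : forall i j, q i j * q j i = 1 /\ q j i * q i j = 1;
  sqt_sigma_bij : forall i, bijective (sigma i);
  sqt_iota_inj : injective iota;
  sqt_x_unit : forall i, x i \is a GRing.unit;
  sqt_xx : forall i j, x i * x j = iota (q j i) * x j * x i;
  sqt_xr : forall i r, x i * iota r = iota (sigma i r) * x i;
  sqt_span : forall f : S, exists (s : seq {ffun 'I_n -> int})
      (c : {ffun 'I_n -> int} -> R),
    f = \sum_(u <- s) iota (c u) * monomial x u;
  sqt_free : forall (s : seq {ffun 'I_n -> int})
      (c : {ffun 'I_n -> int} -> R),
    uniq s -> \sum_(u <- s) iota (c u) * monomial x u = 0 ->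
    forall u, u \in s -> c u = 0
}.

(* A valuation nu : D^* -> Gamma on a division ring D; the value of nu at 0   *)
(* is unconstrained and irrelevant.                                           *)
Record is_valuation (d : Order.disp_t) (D : unitRingType)
    (Gamma : orderedGroupType d) (nu : D -> Gamma) : Prop := {
  valuation_surj : forall g : Gamma, exists2 a : D, a != 0 & nu a = g;
  valuation_mul : forall a b : D, a != 0 -> b != 0 ->
    nu (a * b) = (nu a * nu b)%g;
  valuation_add : forall a b : D, a != 0 -> b != 0 -> a + b != 0 ->
    (Order.min (nu a) (nu b) <= nu (a + b))%O
}.

(* Main.v *)
Require Import Defs.
From mathcomp Require Import all_boot all_order all_algebra.

Set Implicit Arguments.
Unset Strict Implicit.
Unset Printing Implicit Defensive.

Import Order.TTheory GRing.Theory.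

Local Open Scope ring_scope.

(** Let [D] be the division ring of fractions of the torus.  It is reached from
    [K_0 = Q(R)] by adjoining the variables one at a time: [K_k] is the
    division ring of left fractions of the skew polynomial ring
    [K_(k-1)[x_k]], a left Ore domain by the Euclidean algorithm.  Along this
    tower three properties persist (the record [abelian_stage]): every variable
    normalises [K_k], the value of every variable commutes with the values of
    [K_k], and the values of [K_k] commute with each other.  They hold for
    [K_0], whose values are trivial and which the automorphisms [sigma_i]
    preserve.  The values of the variables commute with each other because
    [x_i x_k] is a multiple of [x_k x_i] by an element of [R], of value 1.

    In passing from [K] to [K[y]], two facts are used.

    - Suppose that conjugation by [t] preserves [K] and multiplies [y] by an
      element of [K], and that [nu t] commutes with [nu y] and with the values
      of [K].  Then [nu t] commutes with the value of every [f] in [K[y]]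
      ([commute_val_skew_poly]).  For [f] monic, the conjugate [f'] of [f] has
      a leading coefficient [b] of value 1, so [b f - f'] has lower degree.
      If [nu f] and [nu f'] differ, then [b f - f'] has one of these two
      values, and by induction [nu t] commutes with it; either way it
      commutes with [nu f].  This applies to [t = x_i], and also to
      [t] in [K], so that the values of [K] are central among those of [K[y]].

    - The values of [K[y]] commute ([commute_val_skew_polys]).  Otherwise take
      a monic [h] of least degree whose value fails to commute with some
      [nu g].  Roots are unique in an ordered group, so no positive power of
      [nu h] commutes with [nu g] either.  In the [h]-adic expansion of [g]
      the coefficients have smaller degree than [h], so their values are
      central; hence the nonzero terms have pairwise distinct values and
      [nu g] is a central value times a power of [nu h].  But then [nu g]
      commutes with [nu h], a contradiction. *)

(** * Totally ordered groups *)

Section OrderedGroupTheory.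

Variables (d : Order.disp_t) (G : orderedGroupType d).
Implicit Types x y z w : G.

Lemma ogroup_lt2l z x y : (x < y)%O -> ((z * x)%g < (z * y)%g)%O.
Proof.
rewrite !lt_neqAle => /andP[nxy lexy]; rewrite ogroup_le2l // andbT.
by apply: contra_neq nxy => /mulgI.
Qed.

Lemma ogroup_ltM x y z w :
  (x < y)%O -> (z < w)%O -> ((x * z)%g < (y * w)%g)%O.
Proof.
move=> ltxy ltzw; apply: lt_le_trans (ogroup_lt2l x ltzw) _.
exact/ogroup_le2r/ltW.
Qed.

Lemma ogroup_ltX n x y :
  (x < y)%O -> ((x ^+ n.+1)%g < (y ^+ n.+1)%g)%O.
Proof.
move=> ltxy; elim: n => [//|n IHn].
by rewrite !(expgS _ n.+1); apply: ogroup_ltM.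
Qed.

Lemma ogroup_expgI n x y : (x ^+ n.+1 = y ^+ n.+1)%g -> x = y.
Proof.
move=> eqxy; case: (ltgtP x y) => // /(ogroup_ltX n); by rewrite eqxy ltxx.
Qed.

(** Roots are unique, so a conjugate of [x] with the same power as [x] is
    [x] itself. *)
Lemma ogroup_commute_root n x y : commute (x ^+ n.+1)%g y -> commute x y.
Proof.
move=> xny; have : ((x ^ y) ^+ n.+1 = x ^+ n.+1)%g.
  by rewrite -conjXg conjgE xny mulKg.
by move/ogroup_expgI/conjg_fixP/commgP.
Qed.

End OrderedGroupTheory.

(** * Subrings of a division ring and their left fractions *)

Section DivisionRing.

Variables (D : unitRingType) (divD : division_ring D).
Implicit Types (A K : D -> Prop) (a b c t y f g h : D).

Lemma division_mulf_neq0 a b : a != 0 -> b != 0 -> a * b != 0.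
Proof.
move=> /divD ua; apply: contra_neq => ab0.
by rewrite -[b](mulKr ua) ab0 mulr0.
Qed.

Lemma division_expr_neq0 a n : a != 0 -> a ^+ n != 0.
Proof.
move=> a0; elim: n => [|n IHn]; first by rewrite expr0 oner_neq0.
by rewrite exprS division_mulf_neq0.
Qed.

Lemma division_invr_neq0 a : a != 0 -> a^-1 != 0.
Proof.
move=> /divD ua; apply: contra_neq (oner_neq0 D) => a0.
by rewrite -(divrr ua) a0 mulr0.
Qed.

Lemma division_factors_neq0 a b : a * b != 0 -> a != 0 /\ b != 0.
Proof.
by move=> ab0; split; apply: contra_neq ab0 => ->; rewrite ?mul0r ?mulr0.
Qed.

Record subring_set A : Prop := {
  sr_1 : A 1;
  sr_B : forall a b, A a -> A b -> A (a - b);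
  sr_M : forall a b, A a -> A b -> A (a * b)
}.

Record division_subring K : Prop := {
  ds_subring : subring_set K;
  ds_V : forall a, K a -> K a^-1
}.

Lemma sr_0 A : subring_set A -> A 0.
Proof. by move=> sA; rewrite -(subrr 1); apply: sr_B => //; apply: sr_1. Qed.

Lemma sr_D A a b : subring_set A -> A a -> A b -> A (a + b).
Proof.
move=> sA Aa Ab; rewrite -[b]opprK; apply: sr_B => //.
by rewrite -sub0r; apply: sr_B => //; apply: sr_0.
Qed.

Lemma sr_sum A (I : Type) (s : seq I) (F : I -> D) :
  subring_set A -> (forall i, A (F i)) -> A (\sum_(i <- s) F i).
Proof.
move=> sA AF; apply: (big_ind A) => //; first exact: sr_0.
by move=> *; apply: sr_D.
Qed.

Lemma sr_prod A (I : Type) (s : seq I) (F : I -> D) :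
  subring_set A -> (forall i, A (F i)) -> A (\prod_(i <- s) F i).
Proof.
by move=> sA AF; apply: (big_ind A) => //; [apply: sr_1|apply: sr_M].
Qed.

Lemma ds_exprz K a (u : int) : division_subring K -> K a -> K (a ^ u).
Proof.
move=> dK Ka; have sK := ds_subring dK.
have KX n : K (a ^+ n).
  by elim: n => [|n IHn]; rewrite ?exprS; [apply: sr_1|apply: sr_M].
by case: u => n; [|apply: (ds_V dK)]; apply: KX.
Qed.

Definition left_ore_set A : Prop :=
  forall a b, A a -> A b -> a != 0 -> b != 0 ->
    exists c e, [/\ A c, A e, c != 0 & c * a = e * b].

(** The elements [s^-1 r] with [s], [r] in [A], written without the inverse. *)
Definition fractions A a : Prop := exists s, [/\ A s, s != 0 & A (s * a)].

Lemma sub_fractions A a : subring_set A -> A a -> fractions A a.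
Proof.
by move=> sA Aa; exists 1; rewrite oner_neq0 mul1r; split=> //; apply: sr_1.
Qed.

Lemma left_ore_multiple A a b : subring_set A -> left_ore_set A ->
  A a -> A b -> b != 0 -> exists c e, [/\ A c, A e, c != 0 & c * a = e * b].
Proof.
move=> sA oA Aa Ab b0; have [->|a0] := eqVneq a 0; last exact: oA.
exists 1, 0; rewrite oner_neq0 mulr0 mul0r; split=> //; first exact: sr_1.
exact: sr_0.
Qed.

(** The Ore condition brings the denominators of a difference together, and in
    a product it moves the denominator of the right factor to the left of the
    numerator of the left factor. *)
Lemma fractions_division_subring A :
  subring_set A -> left_ore_set A -> division_subring (fractions A).
Proof.
move=> sA oA; split; first split.
- by apply: sub_fractions => //; apply: sr_1.
- move=> a b [s [As s0 Asa]] [t [At t0 Atb]].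
  have [c [e [Ac Ae c0 cset]]] := left_ore_multiple sA oA As At t0.
  exists (c * s); split; [exact: sr_M|exact: division_mulf_neq0|].
  rewrite mulrBr -mulrA cset -mulrA.
  by apply: sr_B => //; apply: sr_M.
- move=> a b [s [As s0 Asa]] [t [At t0 Atb]].
  have [c [e [Ac Ae c0 cset]]] := left_ore_multiple sA oA Asa At t0.
  exists (c * s); split; [exact: sr_M|exact: division_mulf_neq0|].
  by rewrite mulrA -(mulrA c) cset -mulrA; apply: sr_M.
- move=> a [s [As s0 Asa]]; have [->|a0] := eqVneq a 0.
    by rewrite invr0; apply: sub_fractions => //; apply: sr_0.
  exists (s * a); split=> //; first exact: division_mulf_neq0.
  by rewrite mulrK //; apply: divD.
Qed.

Definition normalises t K : Prop := forall a, K a -> K (t * a / t).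

Lemma conjrM t a b : t != 0 -> t * (a * b) / t = (t * a / t) * (t * b / t).
Proof. by move=> /divD ut; rewrite !mulrA mulrVK. Qed.

Lemma conjr_neq0 t a : t != 0 -> a != 0 -> t * a / t != 0.
Proof.
by move=> t0 a0; rewrite !division_mulf_neq0 ?division_invr_neq0.
Qed.

Lemma normalises_fractions t A :
  t != 0 -> normalises t A -> normalises t (fractions A).
Proof.
move=> t0 tA a [s [As s0 Asa]]; exists (t * s / t); split; first exact: tA.
  exact: conjr_neq0.
by rewrite -conjrM //; apply: tA.
Qed.

Lemma normalises_self K a : division_subring K -> K a -> normalises a K.
Proof.
move=> dK Ka b Kb; have sK := ds_subring dK.
by apply: sr_M => //; [apply: sr_M|apply: ds_V].
Qed.

(** * Skew polynomials *)

(** The powers of [y] may be linearly dependent over [K], so [m] is a strict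
    bound on the degree of one expression of [f]; it is what the inductions on
    the degree run on.  Leading terms come off first. *)
Fixpoint skew_poly K y (m : nat) f : Prop :=
  if m is k.+1 then
    exists c g, [/\ K c, skew_poly K y k g & f = c * y ^+ k + g]
  else f = 0.

Definition skew_polys K y f : Prop := exists m, skew_poly K y m f.

Section SkewPolynomials.

Variables (K : D -> Prop) (dK : division_subring K).
Let sK : subring_set K := ds_subring dK.

Section Conjugation.

Variables (t y : D).
Hypotheses (t0 : t != 0) (tK : normalises t K) (y0 : y != 0)
  (yK : normalises y K) (tyK : K (t * y / t / y)).

(** This quotient is the factor by which conjugation by [t] changes the leading
    coefficient of a monic polynomial of degree [m]. *)
Lemma conjr_exp m : K (t * y ^+ m / t / y ^+ m).
Proof.
have [ut uy] := (divD t0, divD y0).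
elim: m => [|m IHm]; first by rewrite expr0 mulr1 divrr // divr1; apply: sr_1.
have -> : t * y ^+ m.+1 / t / y ^+ m.+1
  = t * y / t / y * (y * (t * y ^+ m / t / y ^+ m) / y).
  rewrite exprS conjrM // invrM ?unitrX //.
  by rewrite !mulrA (mulrVK uy).
by apply: sr_M => //; apply: yK.
Qed.

Lemma skew_poly_conj m f :
  skew_poly K y m f -> skew_poly K y m (t * f / t).
Proof.
elim: m f => [|m IHm] f /=; first by move=> ->; rewrite mulr0 mul0r.
case=> c [g [Kc gP ->]].
exists (t * c / t * (t * y ^+ m / t / y ^+ m)), (t * g / t); split.
- by apply: sr_M; [|apply: tK|apply: conjr_exp].
- exact: IHm.
rewrite mulrDr mulrDl conjrM // -[in RHS]mulrA mulrVK //.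
by apply: unitrX; apply: divD.
Qed.

End Conjugation.

Section Arithmetic.

Variables (y : D).
Hypotheses (y0 : y != 0) (yK : normalises y K).

Local Notation P := (skew_poly K y).

Lemma skew_poly_0 m : P m 0.
Proof.
elim: m => //= m IHm; exists 0, 0; rewrite mul0r addr0; split=> //.
exact: sr_0.
Qed.

Lemma skew_polyB m f g : P m f -> P m g -> P m (f - g).
Proof.
elim: m f g => [|m IHm] f g /=; first by move=> -> ->; rewrite subrr.
move=> [c [f1 [Kc f1P ->]]] [e [g1 [Ke g1P ->]]].
exists (c - e), (f1 - g1); split; [exact: sr_B|exact: IHm|].
by rewrite mulrBl opprD addrACA.
Qed.

Lemma skew_polyD m f g : P m f -> P m g -> P m (f + g).
Proof.
move=> fP gP; rewrite -[g]opprK; apply: skew_polyB => //.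
by rewrite -sub0r; apply: skew_polyB => //; apply: skew_poly_0.
Qed.

Lemma skew_polyS m f : P m f -> P m.+1 f.
Proof.
by move=> fP; exists 0, f; rewrite mul0r add0r; split=> //; apply: sr_0.
Qed.

Lemma skew_poly_leq m p f : (m <= p)%N -> P m f -> P p f.
Proof.
move=> /subnK <-; elim: (p - m)%N => // k IHk fP.
exact/skew_polyS/IHk.
Qed.

Lemma skew_polyZ m c f : K c -> P m f -> P m (c * f).
Proof.
move=> Kc; elim: m f => [|m IHm] f /=; first by move=> ->; rewrite mulr0.
move=> [e [g [Ke gP ->]]]; exists (c * e), (c * g); split=> //.
- exact: sr_M.
- exact: IHm.
by rewrite mulrDr mulrA.
Qed.

Lemma skew_polyXM m f : P m f -> P m.+1 (y * f).
Proof.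
elim: m f => [|m IHm] f; first by move=> ->; rewrite mulr0; apply: skew_poly_0.
move=> [c [g [Kc gP ->]]]; exists (y * c / y), (y * g); split.
- exact: yK.
- exact: IHm.
by rewrite exprS !mulrA mulrVK ?divD // mulrDr !mulrA.
Qed.

Lemma skew_polyXnM k m f : P m f -> P (k + m)%N (y ^+ k * f).
Proof.
move=> fP; elim: k => [|k IHk]; first by rewrite expr0 mul1r.
by rewrite exprS -mulrA addSn; apply: skew_polyXM.
Qed.

Lemma skew_polyM m p f g : P m f -> P p g -> P (m + p)%N (f * g).
Proof.
move=> fP gP; elim: m f fP => [|m IHm] f.
  by move=> ->; rewrite mul0r; apply: skew_poly_0.
move=> [c [f1 [Kc f1P ->]]]; rewrite mulrDl; apply: skew_polyD.
  by rewrite -mulrA; apply/skew_polyS/skew_polyZ => //; apply: skew_polyXnM.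
exact/skew_polyS/IHm.
Qed.

Lemma skew_polyXn m : P m.+1 (y ^+ m).
Proof.
by exists 1, 0; rewrite mul1r addr0; split=> //;
  [apply: sr_1|apply: skew_poly_0].
Qed.

Lemma skew_poly_const c : K c -> P 1 c.
Proof. by move=> Kc; exists c, 0; rewrite expr0 mulr1 addr0. Qed.

Lemma skew_polys_subring : subring_set (skew_polys K y).
Proof.
split; first by exists 1%N; apply: skew_poly_const; apply: sr_1.
- move=> f g [m fP] [p gP]; exists (maxn m p); apply: skew_polyB.
    by apply: skew_poly_leq fP; rewrite leq_maxl.
  by apply: skew_poly_leq gP; rewrite leq_maxr.
- by move=> f g [m fP] [p gP]; exists (m + p)%N; apply: skew_polyM.
Qed.

(** The truncated subtraction makes [q = 0] when [p <= m]. *)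
Lemma skew_poly_divmod m p g f : P m g -> P p f ->
  exists q r, [/\ P (p - m)%N q, P m r & f = q * (y ^+ m + g) + r].
Proof.
move=> gP; elim: p f => [|p IHp] f fP.
  exists 0, 0; rewrite fP mul0r addr0; split=> //; exact: skew_poly_0.
have [ltpm|lemp] := ltnP p m.
  exists 0, f; rewrite mul0r add0r; split=> //; first exact: skew_poly_0.
  exact: skew_poly_leq fP.
case: fP => c [f1 [Kc f1P ->]].
(* c y^(p-m) is the leading term of the quotient *)
have : P p (f1 - c * (y ^+ (p - m) * g)).
  apply: skew_polyB => //; apply: skew_polyZ => //.
  by rewrite -{1}(subnK lemp); apply: skew_polyXnM.
case/IHp=> q [r [qP rP f1E]]; exists (c * y ^+ (p - m) + q), r; split=> //.
  by rewrite subSn //; exists c, q.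
rewrite mulrDl -addrA -f1E mulrDr -!mulrA -exprD subnK // -addrA.
by congr (_ + _); rewrite addrC subrK.
Qed.

Lemma skew_poly_monic m c g : K c -> c != 0 -> P m g ->
  exists2 g1, P m g1 & c * y ^+ m + g = c * (y ^+ m + g1).
Proof.
move=> Kc c0 gP; exists (c^-1 * g).
  by apply: skew_polyZ => //; apply: ds_V.
by rewrite mulrDr mulVKr ?divD.
Qed.

(** The Euclidean algorithm: a common left multiple of the divisor [g] and of
    the remainder of [f] gives one of [f] and [g]. *)
Lemma skew_polys_ore : left_ore_set (skew_polys K y).
Proof.
have sP := skew_polys_subring.
suff ore m f g : skew_polys K y f -> P m g -> g != 0 ->
    exists c e, [/\ skew_polys K y c, skew_polys K y e, c != 0
                  & c * f = e * g].
  by move=> f g fP [m gP] _; apply: ore gP.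
elim: m f g => [|m IHm] f g fP; first by move=> ->; rewrite eqxx.
move=> [c [g1 [Kc g1P ->]]]; have [->|c0] := eqVneq c 0.
  by rewrite mul0r add0r; apply: IHm.
have [g2 g2P ->] := skew_poly_monic Kc c0 g1P.
set h := y ^+ m + g2 => ch0; have [_ h0] := division_factors_neq0 ch0.
have hP : skew_polys K y h.
  by exists m.+1; exact: skew_polyD (skew_polyXn m) (skew_polyS g2P).
have [p fP'] := fP.
have [q [r [qP rP fE]]] := skew_poly_divmod g2P fP'.
have cP e : K e -> skew_polys K y e.
  by move=> Ke; exists 1%N; apply: skew_poly_const.
have {qP} qP : skew_polys K y q by exists (p - m)%N.
suff [a [b [aP bP a0 abE]]] : exists a b, [/\ skew_polys K y a,
    skew_polys K y b, a != 0 & a * f = b * h].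
  exists a, (b / c); split=> //; last by rewrite mulrA mulrVK ?divD.
  by apply: sr_M => //; apply: cP; apply: ds_V.
have [r0|r0] := eqVneq r 0.
  exists 1, q; rewrite oner_neq0 mul1r fE r0 addr0; split=> //; exact: sr_1.
have [a [b [aP bP a0 abE]]] := IHm h r hP rP r0.
have b0 : b != 0.
  have [] // := @division_factors_neq0 b r.
  by rewrite -abE; apply: division_mulf_neq0.
exists b, (b * q + a); split=> //; first by apply: sr_D => //; apply: sr_M.
by rewrite fE mulrDr -abE mulrDl mulrA.
Qed.

End Arithmetic.

End SkewPolynomials.

(** * Valuations *)

Section Valuation.

Variables (d : Order.disp_t) (Gamma : orderedGroupType d) (nu : D -> Gamma).
Hypothesis val : is_valuation nu.

Lemma val_M a b : a != 0 -> b != 0 -> nu (a * b) = (nu a * nu b)%g.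
Proof. exact: (valuation_mul val). Qed.

Lemma val_1 : nu 1 = 1%g.
Proof.
apply: (mulgI (nu 1)); rewrite mulg1 -val_M ?oner_neq0 //.
by rewrite mulr1.
Qed.

Lemma val_V a : a != 0 -> nu a^-1 = (nu a)^-1%g.
Proof.
move=> a0; apply: (mulgI (nu a)); rewrite -val_M ?division_invr_neq0 //.
by rewrite divrr ?divD // mulgV val_1.
Qed.

Lemma val_X a n : a != 0 -> nu (a ^+ n) = (nu a ^+ n)%g.
Proof.
move=> a0; elim: n => [|n IHn]; first by rewrite expr0 expg0 val_1.
by rewrite exprS expgS val_M ?IHn //; apply: division_expr_neq0.
Qed.

Lemma val_N a : a != 0 -> nu (- a) = nu a.
Proof.
move=> a0; have N1 : (-1 : D) != 0 by rewrite oppr_eq0 oner_neq0.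
rewrite -mulN1r val_M //; suff -> : nu (-1) = 1%g by rewrite mul1g.
apply: (@ogroup_expgI _ _ 1); rewrite -val_X //.
by rewrite expr2 mulrNN mulr1 val_1 expg1n.
Qed.

(** The ultrametric inequality for [a + b] and for [a = (a + b) - b] pins down
    the value of the sum. *)
Lemma val_add_lt a b : a != 0 -> b != 0 -> (nu a < nu b)%O ->
  a + b != 0 /\ nu (a + b) = nu a.
Proof.
move=> a0 b0 ltab; have ab0 : a + b != 0.
  rewrite addr_eq0; apply: contraTneq ltab => ->.
  by rewrite val_N // ltxx.
split=> //; apply: le_anti; apply/andP; split.
  have := valuation_add val ab0 (_ : - b != 0).
  rewrite oppr_eq0 addrK val_N // => /(_ b0 a0).
  by rewrite ge_min [(nu b <= _)%O]leNgt ltab orbF.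
by have := valuation_add val a0 b0 ab0; rewrite (min_idPl (ltW ltab)).
Qed.

Lemma val_add_neq a b : a != 0 -> b != 0 -> nu a <> nu b ->
  a + b != 0 /\ (nu (a + b) = nu a \/ nu (a + b) = nu b).
Proof.
move=> a0 b0; case: (ltgtP (nu a) (nu b)) => // ltab _.
  by have [? ->] := val_add_lt a0 b0 ltab; split; [|left].
by rewrite addrC; have [? ->] := val_add_lt b0 a0 ltab; split; [|right].
Qed.

Lemma val_conj t a : t != 0 -> a != 0 ->
  nu (t * a / t) = (nu t * nu a / nu t)%g.
Proof.
move=> t0 a0; rewrite val_M ?division_invr_neq0 //; last first.
  exact: division_mulf_neq0.
by rewrite val_M // val_V.
Qed.

Section OneVariable.

Variables (K : D -> Prop) (dK : division_subring K) (y : D).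
Hypotheses (y0 : y != 0) (yK : normalises y K).

(** Conjugation by [t] acts on [f] nearly as a scalar: it keeps the degree and,
    for [f] monic, gives a leading coefficient [b] of value 1.  The difference
    of [b * f] and the conjugate has lower degree and, if the values of [f] and
    of its conjugate differ, it has one of the two. *)
Lemma commute_val_skew_poly t m f : t != 0 -> normalises t K ->
  K (t * y / t / y) -> commute (nu t) (nu y) ->
  (forall a, K a -> a != 0 -> commute (nu t) (nu a)) ->
  skew_poly K y m f -> f != 0 -> commute (nu t) (nu f).
Proof.
move=> t0 tK tyK cty ctK; have sK := ds_subring dK.
elim: m f => [|m IHm] f; first by move=> ->; rewrite eqxx.
move=> [c [g [Kc gP ->]]]; have [->|c0] := eqVneq c 0.
  by rewrite mul0r add0r; apply: IHm.
have [g1 g1P ->] := skew_poly_monic dK Kc c0 gP.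
set h := y ^+ m + g1 => ch0; have [_ h0] := division_factors_neq0 ch0.
rewrite val_M //; apply: commuteM; first exact: ctK.
have ym0 : y ^+ m != 0 by apply: division_expr_neq0.
pose b := t * y ^+ m / t / y ^+ m.
have Kb : K b by apply: conjr_exp.
have b0 : b != 0.
  by apply: division_mulf_neq0; rewrite ?division_invr_neq0 ?conjr_neq0.
have nub : nu b = 1%g.
  rewrite /b val_M ?conjr_neq0 ?division_invr_neq0 // val_conj // val_V //.
  by rewrite val_X // (commuteX m cty) mulgK mulgV.
have [eqh|neqh] := eqVneq (nu h) (nu (t * h / t)).
  by rewrite /commute {2}eqh val_conj // mulgVK.
have lowP : skew_poly K y m (b * h - t * h / t).
  rewrite /h !mulrDr mulrDl (_ : t * y ^+ m / t = b * y ^+ m); last first.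
    by rewrite mulrVK // unitrX ?divD.
  rewrite opprD addrACA subrr add0r; apply: skew_polyB => //.
    exact: skew_polyZ.
  exact: skew_poly_conj.
have [||| low0 lowE] := @val_add_neq (b * h) (- (t * h / t)).
- exact: division_mulf_neq0.
- by rewrite oppr_eq0 conjr_neq0.
- by rewrite val_N ?conjr_neq0 // val_M // nub mul1g; apply/eqP.
have := IHm _ lowP low0.
case: lowE => ->; first by rewrite val_M // nub mul1g.
rewrite val_N ?conjr_neq0 // val_conj // /commute mulgVK => /mulgI cth.
by rewrite -{2}cth mulgVK.
Qed.

(** If the value of a monic [h] of least degree failed to commute with [nu g],
    the terms of the [h]-adic expansion of [g] would have distinct values, and
    [nu g] would be a value of smaller degree times a power of [nu h]. *)
Lemma commute_val_skew_polys f g :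
  (forall a h, K a -> a != 0 -> skew_polys K y h -> h != 0 ->
    commute (nu a) (nu h)) ->
  skew_polys K y f -> skew_polys K y g -> f != 0 -> g != 0 ->
  commute (nu f) (nu g).
Proof.
move=> cK [m fP] gP; have sK := ds_subring dK.
elim: m f fP g gP => [|m IHm] f; first by move=> -> g _; rewrite eqxx.
move=> [c [f1 [Kc f1P ->]]] g gP; have [->|c0] := eqVneq c 0.
  by rewrite mul0r add0r; apply: IHm.
case: m => [|m] in IHm f1P *.
  by move: f1P => /= ->; rewrite expr0 mulr1 addr0 => ? ?; apply: cK.
have [f2 f2P ->] := skew_poly_monic (m := m.+1) dK Kc c0 f1P.
set h := y ^+ m.+1 + f2 => ch0 g0.
have [_ h0] := division_factors_neq0 ch0.
rewrite val_M //; apply/commute_sym/commuteM; apply: commute_sym.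
  exact: cK.
have [//|ncomm] := eqVneq (nu h * nu g)%g (nu g * nu h)%g.
have hP : skew_polys K y h.
  exists m.+2; apply: skew_polyD => //; first exact: skew_polyXn.
  exact: skew_polyS.
(* the h-adic expansion, one division by h at a time *)
have expand p e : skew_poly K y p e -> e != 0 -> exists i a,
    [/\ skew_poly K y m.+1 a, a != 0 & nu e = (nu a * nu h ^+ i)%g].
  elim/ltn_ind: p e => -[|p] IHp e eP; first by rewrite eP eqxx.
  move=> e0; have [q [r [qP rP eE]]] := skew_poly_divmod dK y0 yK f2P eP.
  have [q0|q0] := eqVneq q 0.
    move: e0; rewrite eE q0 mul0r add0r => r0.
    by exists 0%N, r; rewrite expg0 mulg1.
  have ltp : (p.+1 - m.+1 < p.+1)%N by rewrite subSS ltnS leq_subr.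
  have [i [a [aP a0 qE]]] := IHp _ ltp _ qP q0.
  have qhE : nu (q * h) = (nu a * nu h ^+ i.+1)%g.
    by rewrite val_M // qE expgSr mulgA.
  have [r0|r0] := eqVneq r 0.
    by exists i.+1, a; rewrite eE r0 addr0.
  case: (@val_add_neq (q * h) r) => //; first exact: division_mulf_neq0.
    (* equal values would make a power of nu h a quotient of values of smaller
       degree, which commute with nu g *)
    move=> eqv; case/eqP: ncomm; apply: (@ogroup_commute_root _ _ i).
    have -> : (nu h ^+ i.+1 = (nu a)^-1 * nu r)%g by rewrite -eqv qhE mulKg.
    apply/commute_sym/commuteM; first apply: commuteV.
      by apply/commute_sym/IHm.
    by apply/commute_sym/IHm.
  rewrite -eE => _ [->|->]; first by exists i.+1, a.
  by exists 0%N, r; rewrite expg0 mulg1.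
have [p gP'] := gP; have [i [a [aP a0 ->]]] := expand p g gP' g0.
apply: commuteM; last exact: commuteX.
by apply/commute_sym/IHm.
Qed.

End OneVariable.

(** * Adjoining the variables one by one *)

Section Tower.

Variables (I : eqType) (x : I -> D).
Hypothesis x0 : forall i, x i != 0.

(** What one step of the tower needs from [K] and hands on to the next; the
    first three properties are there to keep the last one going. *)
Record abelian_stage K : Prop := {
  stage_division : division_subring K;
  stage_normalised : forall i, normalises (x i) K;
  stage_variable : forall i a, K a -> a != 0 -> commute (nu (x i)) (nu a);
  stage_abelian : forall a b, K a -> K b -> a != 0 -> b != 0 ->
    commute (nu a) (nu b)
}.

Lemma val_fraction A a : fractions A a -> a != 0 ->
  exists s r, [/\ A s, A r, s != 0, r != 0 & nu a = ((nu s)^-1 * nu r)%g].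
Proof.
move=> [s [As s0 Asa]] a0; exists s, (s * a); split=> //.
  exact: division_mulf_neq0.
by rewrite val_M // mulKg.
Qed.

Lemma commute_val_fractions (u : Gamma) A :
  (forall a, A a -> a != 0 -> commute u (nu a)) ->
  forall a, fractions A a -> a != 0 -> commute u (nu a).
Proof.
move=> cA a aF a0; have [s [r [As Ar s0 r0 ->]]] := val_fraction aF a0.
by apply: commuteM; [apply/commuteV/cA|apply: cA].
Qed.

(** [commute_val_skew_poly] is used twice: with [t] a variable, which carries
    [stage_variable] over to [K[x_k]], and with [t] in [K], which gives the
    centrality that [commute_val_skew_polys] asks for. *)
Lemma abelian_stage_adjoin K k :
  (forall i, K (x i * x k / x i / x k)) ->
  (forall i, commute (nu (x i)) (nu (x k))) ->
  abelian_stage K ->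
  exists K', [/\ abelian_stage K', forall a, K a -> K' a & K' (x k)].
Proof.
move=> qK xx [dK xK cxK cK]; have sK := ds_subring dK.
have sP : subring_set (skew_polys K (x k)) by apply: skew_polys_subring.
have KP a : K a -> skew_polys K (x k) a.
  by move=> Ka; exists 1%N; apply: skew_poly_const.
have oP : left_ore_set (skew_polys K (x k)) by apply: skew_polys_ore.
have xP i f : skew_polys K (x k) f -> f != 0 -> commute (nu (x i)) (nu f).
  by move=> [m fP]; apply: commute_val_skew_poly fP => // a; apply: cxK.
(* for t = a in K, the factor a y a^-1 y^-1 is a times a conjugate of a^-1 *)
have aP a f : K a -> a != 0 -> skew_polys K (x k) f -> f != 0 ->
    commute (nu a) (nu f).
  move=> Ka a0 [m fP]; apply: commute_val_skew_poly fP => //.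
  - exact: normalises_self.
  - rewrite -!mulrA; apply: sr_M => //; rewrite mulrA.
    by apply: xK; apply: ds_V.
  - by apply/commute_sym/cxK.
  - by move=> b Kb; apply: cK.
exists (fractions (skew_polys K (x k))); split.
- split.
  + exact: fractions_division_subring.
  + move=> i; apply: normalises_fractions => // f [m fP]; exists m.
    exact: skew_poly_conj.
  + by move=> i; apply: commute_val_fractions; apply: xP.
  + move=> a b aF bF a0 b0; apply: commute_val_fractions bF b0 => f fP f0.
    apply: commute_sym; move: a aF a0; apply: commute_val_fractions => g gP g0.
    exact: (@commute_val_skew_polys K dK (x k)).
- by move=> a Ka; apply: sub_fractions => //; apply: KP.
- apply: sub_fractions => //; exists 2%N.
  by rewrite -[x k]expr1; apply: skew_polyXn.
Qed.

Lemma abelian_stage_adjoin_seq K (s : seq I) :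
  (forall i k, K (x i * x k / x i / x k)) ->
  (forall i k, commute (nu (x i)) (nu (x k))) ->
  abelian_stage K ->
  exists K', [/\ abelian_stage K', forall a, K a -> K' a
    & forall i, i \in s -> K' (x i)].
Proof.
move=> qK xx stK; elim: s => [|k s [K1 [stK1 KK1 sK1]]]; first by exists K.
have [i|K2 [stK2 K12 K2k]] := @abelian_stage_adjoin K1 k _ (xx^~ k) stK1.
  exact/KK1/qK.
exists K2; split=> // [a Ka|i]; first exact/K12/KK1.
by rewrite inE => /orP[/eqP->|/sK1 /K12].
Qed.

End Tower.

End Valuation.

End DivisionRing.

(** * Skew quantum tori *)

Theorem theorem3p28 (n : nat) (R : nzRingType) (q : 'M[R]_n)
    (sigma : 'I_n -> {rmorphism R -> R})
    (S : unitRingType) (iota : {rmorphism R -> S}) (x : 'I_n -> S)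
    (D : unitRingType) (j : {rmorphism S -> D})
    (d : Order.disp_t) (Gamma : orderedGroupType d) (nu : D -> Gamma) :
  (2 <= n)%N ->
  left_ore_domain R ->
  is_skew_quantum_torus q sigma iota x ->
  is_left_quotient_division_ring j ->
  is_valuation nu ->
  (forall a : D, a != 0 -> left_fraction (fun r : R => j (iota r)) a ->
    nu a = 1%g) ->
  forall g h : Gamma, (g * h = h * g)%g.
Proof.
move=> _ [_ oreR] torus [divD j_inj fracD] val nuR.
pose f r := j (iota r); pose X i := j (x i).
have f0 r : r != 0 -> f r != 0.
  apply: contra_neq => fr0; apply: (sqt_iota_inj torus); apply: j_inj.
  by rewrite !rmorph0.
have uX i : X i \is a GRing.unit.
  exact/rmorph_unit/(sqt_x_unit torus).
have X0 i : X i != 0 by apply: contraTneq (uX i) => ->; rewrite unitr0.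
pose A a := exists r, a = f r.
have sA : subring_set A.
  split; first by exists 1; rewrite /f !rmorph1.
  - by move=> _ _ [r ->] [s ->]; exists (r - s); rewrite /f !rmorphB.
  - by move=> _ _ [r ->] [s ->]; exists (r * s); rewrite /f !rmorphM.
have oA : left_ore_set A.
  move=> _ _ [r ->] [s ->] fr0 fs0.
  have ne0 t : f t != 0 -> t != 0.
    by apply: contra_neq => ->; rewrite /f !rmorph0.
  have [c [e [ceE cr0]]] := oreR r s (ne0 _ fr0) (ne0 _ fs0).
  exists (f c), (f e); split; [by exists c|by exists e| |].
    by apply: f0; apply: contra_neq cr0 => ->; rewrite mul0r.
  by rewrite /f -!rmorphM ceE.
have Xf i r : X i * f r / X i = f (sigma i r).
  by rewrite /X /f -rmorphM (sqt_xr torus) rmorphM (mulrK (uX i)).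
pose K0 := fractions A.
have dK0 : division_subring K0 by apply: fractions_division_subring.
have nuK0 a : K0 a -> a != 0 -> nu a = 1%g.
  move=> [_ [[s ->] fs0 [r rE]]] a0; apply: nuR => //; exists s, r; split.
    by apply: contra_neq fs0 => ->; rewrite /f !rmorph0.
  by rewrite -[j (iota r)]rE mulKr //; apply: divD.
have qE i k : X i * X k / X i / X k = f (q k i).
  rewrite /X /f -rmorphM (sqt_xx torus) !rmorphM.
  by rewrite (mulrK (uX i)) (mulrK (uX k)).
have nuf r : f r != 0 -> nu (f r) = 1%g.
  by move=> fr0; apply: nuK0 => //; apply: sub_fractions => //; exists r.
have qf0 i k : f (q i k) != 0.
  by rewrite -qE !(division_mulf_neq0, division_invr_neq0).
have XX i k : commute (nu (X i)) (nu (X k)).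
  rewrite /commute -!(val_M val) //.
  have -> : X i * X k = f (q k i) * (X k * X i).
    by rewrite -qE mulrA !mulrVK.
  by rewrite (val_M val) ?division_mulf_neq0 // nuf // mul1g.
have stK0 : abelian_stage nu X K0.
  split=> //.
  - move=> i; apply: normalises_fractions => // _ [r ->].
    by exists (sigma i r); rewrite Xf.
  - by move=> i a Ka a0; rewrite (nuK0 a) //; apply: commute1.
  - by move=> a b Ka Kb a0 b0; rewrite (nuK0 b) //; apply: commute1.
have qK0 i k : K0 (X i * X k / X i / X k).
  by rewrite qE; apply: sub_fractions => //; exists (q k i).
have [K [[dK _ _ cK] K0K KX]] :=
  abelian_stage_adjoin_seq divD val X0 (enum 'I_n) qK0 XX stK0.
have sK := ds_subring dK.
have KS s : K (j s).
  have [us [c ->]] := sqt_span torus s.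
  rewrite rmorph_sum; apply: sr_sum => // u; rewrite rmorphM.
  apply: sr_M => //.
    by apply: K0K; apply: sub_fractions => //; exists (c u).
  rewrite rmorph_prod; apply: sr_prod => // i.
  rewrite rmorphXz ?(sqt_x_unit torus) //.
  by apply: ds_exprz => //; apply: KX; rewrite mem_enum.
have KD a : K a.
  have [s [r [_ ->]]] := fracD a.
  by apply: sr_M => //; apply: ds_V.
move=> g h.
have [a a0 <-] := valuation_surj val g; have [b b0 <-] := valuation_surj val h.
exact: cK.
Qed.
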